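(* For every $z\in\mathbb{C}$, the infinite matrix $S(z)=(S_{kj}(z))_{k,j\ge0}$ satisfies $$z\,S(z)=B\,S(z)+\mathrm{i}\,S(z)\,B^\top+4\,\mathbf{e}_0\mathbf{e}_0^\top,$$ where $B$ is the infinite tridiagonal matrix $$B=\begin{pmatrix}0&1\\1/3&0&2/3\\&2/5&0&3/5\\&&3/7&0&4/7\\&&&4/9&0&\ddots\\&&&&\ddots&\ddots\end{pmatrix},$$ that is (indexing from $0$) $B_{k,k-1}=\frac{k}{2k+1}$ for $k\ge 1$, $B_{k,k+1}=\frac{k+1}{2k+1}$ for $k\ge0$, and all other entries vanish.
   Context: $P_k$ is the $k$-th Legendre polynomial, $\Omega=[-1,1]^2$, and $$S_{kj}(z)=\iint_\Omega\frac{P_k(s)P_j(t)}{z-(s+\mathrm{i}t)}\,ds\,dt,\qquad k,j\ge0,$$ (an absolutely convergent integral for every $z\in\mathbb{C}$). $S(z)$ is the infinite matrix with $(k,j)$ entry $S_{kj}(z)$. Infinite matrices are indexed from $0$, $\mathbf{e}_0$ is the first standard basis vector, and products with tridiagonal matrices are entrywise finite sums. *)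

(* Defs.v *)
From mathcomp Require Export all_boot all_order all_algebra.
From mathcomp Require Export all_classical all_reals all_analysis.
From mathcomp.real_closed Require Export complex.

Set Implicit Arguments.
Unset Strict Implicit.
Unset Printing Implicit Defensive.

Export Order.TTheory GRing.Theory Num.Theory.

Local Open Scope classical_set_scope.
Local Open Scope ring_scope.
Local Open Scope complex_scope.

(* Rodrigues' formula. *)
Definition legendre (R : realType) (k : nat) : {poly R} :=
  ((2 ^ k * k`!)%N%:R)^-1 *: (('X ^+ 2 - 1) ^+ k)^`(k).

(* Lebesgue integral of a complex-valued function of two real variables;
   meaningful when the real and imaginary parts are integrable on D. *)
Definition cintegral2 (R : realType) (D : set (R * R)) (f : R * R -> R[i])
    : R[i] :=
  (\int[(@lebesgue_measure R \x @lebesgue_measure R)%E]_(p in D)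
      complex.Re (f p))
  +i* (\int[(@lebesgue_measure R \x @lebesgue_measure R)%E]_(p in D)
      complex.Im (f p)).

Definition square (R : realType) : set (R * R) := `[-1, 1] `*` `[-1, 1].

Definition infmx (T : Type) := nat -> nat -> T.

Definition infmx_tr (T : Type) (A : infmx T) : infmx T := fun k j => A j k.

(* The sum ranges over the l for which the summand is nonzero; it has its
   intended meaning only when these l are finitely many, as happens when A is
   tridiagonal or C is the transpose of a tridiagonal matrix. *)
Definition infmx_mul (T : pzSemiRingType) (A C : infmx T) : infmx T :=
  fun k j => \sum_(l \in [set: nat]) A k l * C l j.

Definition inf_e0 (T : pzSemiRingType) (k : nat) : T := (k == 0%N)%:R.

Definition inf_outer (T : pzSemiRingType) (u v : nat -> T) : infmx T :=
  fun k j => u k * v j.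

(* At the single point s + i t = z the integrand is 0, since 0^-1 = 0. *)
Definition Smx (R : realType) (z : R[i]) : infmx R[i] := fun k j =>
  cintegral2 (@square R) (fun p : R * R =>
    (((legendre R k).[p.1])%:C * ((legendre R j).[p.2])%:C)
      / (z - (p.1 +i* p.2))).

Definition Bmx (R : realType) : infmx R[i] := fun k l =>
  if l.+1 == k then k%:R / (2 * k + 1)%N%:R
  else if l == k.+1 then (k + 1)%N%:R / (2 * k + 1)%N%:R
  else 0.

(* Main.v *)
Require Import Defs.
From mathcomp Require Import ring lra zify measurable_realfun.

(** Write w = s + i t. Off the single point w = z one has
    [z / (z - w) = 1 + w / (z - w) = 1 + s / (z - w) + i t / (z - w)].
    Multiplying by [P_k(s) P_j(t)] and integrating over the square gives
    [z S_kj = (int P_k) (int P_j) + T(X P_k, P_j) + i T(P_k, X P_j)], where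
    [T(P, Q)] is the integral of [P(s) Q(t) / (z - w)] ([mul_cauchy_transform]).
    The map T is bilinear, and the three-term recurrence
    [(2k+1) X P_k = k P_(k-1) + (k+1) P_(k+1)] ([legendre_recurrence]) turns the
    last two terms into row k of B times column j of S, and i times row k of S
    times row j of B. The first term is 4 for k = j = 0 and 0 otherwise, since
    [P_k] integrates to 2 for k = 0 and to 0 for k > 0
    ([Rintegral_legendre]).

    Three points need an argument. The recurrence is derived from Rodrigues'
    formula: with [u = X^2 - 1], the (n+2)-nd derivative of [u^(n+2)] can be
    expanded by differentiating [u^(n+2)] first once or first twice, and
    eliminating the n-th derivative of [u^(n+1)] between the two expansions
    leaves the recurrence. The mean value of [P_k] is zero for k > 0 because
    [P_k] is the derivative of a polynomial divisible by u. Splitting the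
    integral requires that [1 / (z - w)] be integrable on the square although
    it is unbounded there ([integrable_inv_distance]): it is dominated by
    [1 + sum_n 2^n 1_(Q_n)], where [Q_n] is the square of half-side [2 / 2^n]
    centred at z, and the n-th term of this series has integral [16 / 2^n]. *)

Import numFieldNormedType.Exports.

Set Implicit Arguments.
Unset Strict Implicit.
Unset Printing Implicit Defensive.

Local Open Scope classical_set_scope.
Local Open Scope ring_scope.
Local Open Scope complex_scope.

Local Notation plane R := (measurableTypeR R * measurableTypeR R)%type.
Local Notation area R := (@lebesgue_measure R \x @lebesgue_measure R)%E.

(** * Legendre polynomials *)

Lemma derivnXM (R : comNzRingType) (p : {poly R}) n :
  ('X * p)^`(n.+1) = 'X * p^`(n.+1) + p^`(n) *+ n.+1.
Proof.
elim: n => [|n IHn]; first by rewrite !derivn1 derivM derivX mul1r addrC.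
rewrite derivnS IHn derivD derivM derivX mul1r derivMn -!derivnS.
by rewrite addrAC -mulrS addrC.
Qed.

(** The Legendre polynomial without its normalising factor [1 / (2^n n!)]; the
    recurrence for it has integer coefficients. *)
Definition rodrigues (R : numFieldType) (n : nat) : {poly R} :=
  (('X ^+ 2 - 1) ^+ n)^`(n).

(** With [V] the n-th derivative of [u^(n+1)], equation [A] comes from
    [D u^(m+1) = 2 (m+1) X u^m] and the Leibniz rule, equation [B] from
    [D^2 u^(n+2)], in which [X^2] is replaced by [u + 1]. In the combination
    [(2 n + 3) A - (n + 1) B] the terms in [V] cancel. *)
Lemma rodrigues_recurrence (R : numFieldType) n :
  rodrigues R n.+2 = (2 * (2 * n.+1 + 1))%:R * ('X * rodrigues R n.+1)
     - (4 * n.+1 ^ 2)%:R * rodrigues R n.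
Proof.
set u : {poly R} := 'X ^+ 2 - 1.
have du : u^`() = 'X *+ 2.
  by rewrite derivB derivXn derivC subr0 expr1.
have dS m : (u ^+ m.+1)^`() = ('X * u ^+ m) *+ (2 * m.+1).
  by rewrite deriv_exp du /= mulrnA mulrnAl.
pose V := (u ^+ n.+1)^`(n).
have A : rodrigues R n.+2 = ('X * rodrigues R n.+1 + V *+ n.+1) *+ (2 * n.+2).
  by rewrite /rodrigues -/u derivSn dS derivnMn derivnXM.
have B : rodrigues R n.+2 =
    V *+ (2 * n.+2 * (2 * n + 3)) + rodrigues R n *+ (4 * n.+1 * n.+2).
  rewrite /rodrigues -/u /V derivSn derivSn dS derivMn derivM derivX mul1r dS.
  rewrite -!derivnMn -derivnD; congr derivn.
  have -> : 'X * ('X * u ^+ n *+ (2 * n.+1)) =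
      (u ^+ n.+1 + u ^+ n) *+ (2 * n.+1).
    rewrite mulrnAr mulrA -expr2 -(subrK 1 ('X ^+ 2)) -/u.
    by rewrite mulrDl mul1r -exprS.
  by rewrite -!(mulr_natl (_ + _)) -!(mulr_natl (_ ^+ _)); ring.
have n2 : (n.+2)%:R != 0 :> {poly R}.
  by rewrite -polyC_natr polyC_eq0 pnatr_eq0.
apply: (mulfI n2).
move: A B; rewrite -(mulr_natl V) -(mulr_natl (_ + _)) -(mulr_natl V).
rewrite -(mulr_natl (rodrigues R n)); move: (rodrigues R n.+2) => W2 A B.
have -> : n.+2%:R * W2 = (2 * n + 3)%:R * W2 - (n.+1)%:R * W2 by ring.
by rewrite {1}A B; ring.
Qed.

Lemma legendreE (R : realType) k :
  legendre R k = ((2 ^ k * k`!)%N%:R)^-1 *: rodrigues R k.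
Proof. by []. Qed.

(** Writing the lower index as [k.-1] makes the formula uniform in k: for
    [k = 0], where [0.-1 = 0], its coefficient is 0. *)
Lemma legendre_recurrence (R : realType) k :
  'X * legendre R k = (k%:R / (2 * k + 1)%:R) *: legendre R k.-1
                    + ((k + 1)%:R / (2 * k + 1)%:R) *: legendre R k.+1.
Proof.
case: k => [|k].
  rewrite mul0r scale0r add0r divr1 scale1r !legendreE /rodrigues.
  rewrite derivn1 expr0 expr1 derivn0 derivB derivXn derivC subr0 expr1.
  rewrite expn0 expn1 !fact0 !muln1 invr1 scale1r mulr1.
  rewrite -(scaler_nat 2 'X) scalerA.
  by rewrite mulVf ?scale1r ?pnatr_eq0.
rewrite !legendreE rodrigues_recurrence /= -!polyC_natr !mul_polyC.
(* Collect the two basis polynomials: the coefficient of the lower one is 0. *)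
rewrite -scalerAr !scalerBr !scalerA addrCA -scalerBl.
have f0 : k`!%:R != 0 :> R by rewrite pnatr_eq0 -lt0n fact_gt0.
have t0 : 2 ^+ k != 0 :> R by rewrite expf_neq0 ?pnatr_eq0.
have k1 : 1 + k%:R != 0 :> R by rewrite nat1r pnatr_eq0.
have k2 : 2 + k%:R != 0 :> R by rewrite -[2]/(2%:R) -natrD pnatr_eq0.
have k3 : 2 * (1 + k%:R) + 1 != 0 :> R.
  by rewrite nat1r -[2]/(2%:R) -natrM natr1 pnatr_eq0.
rewrite [X in X *: rodrigues R k](_ : _ = 0) ?scale0r ?addr0.
  congr (_ *: _).
  by rewrite !factS !expnS !natrM !natrX; field; rewrite f0 k1 k2 t0.
by rewrite !factS !expnS !natrM !natrX; field; rewrite f0 k1 k2 t0.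
Qed.

(** * Integrals of polynomials over the interval and the square *)

Lemma Rintegral_deriv_poly (R : realType) (p : {poly R}) (a b : R) : a < b ->
  \int[lebesgue_measure]_(x in `[a, b]) p^`().[x] = p.[b] - p.[a].
Proof.
move=> ab; rewrite /Rintegral (@continuous_FTC2 _ _ (horner p))//.
- by apply: continuous_subspaceT; exact: continuous_horner.
- split.
  + by move=> x _; exact: derivable_horner.
  + by apply: cvg_at_right_filter; exact: continuous_horner.
  + by apply: cvg_at_left_filter; exact: continuous_horner.
- by move=> x _; rewrite -derivE.
Qed.

(** Each derivative lowers the multiplicity of a root by at most one. *)
Lemma derivn_expr_factor (R : comNzRingType) (u : {poly R}) m i :
  exists q, (u ^+ (i + m))^`(i) = u ^+ m * q.
Proof.
elim: i m => [|i IHi] m; first by exists 1; rewrite derivn0 mulr1.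
rewrite addSnnS derivnS; have [q ->] := IHi m.+1.
exists (u^`() * q *+ m.+1 + u * q^`()).
by rewrite derivM deriv_exp /= exprS; ring.
Qed.

(** For [k > 0] an antiderivative of [P_k] is the derivative of order
    [k - 1] of [(X^2 - 1)^k] up to a constant factor, which vanishes at both
    ends. *)
Lemma Rintegral_legendre (R : realType) k :
  \int[lebesgue_measure]_(x in `[(-1)%R, 1%R]) (legendre R k).[x]
  = (k == 0%N)%:R *+ 2.
Proof.
have lt11 : -1 < 1 :> R by rewrite gtrN.
case: k => [|k].
  under eq_Rintegral do
    rewrite legendreE /rodrigues expr0 derivn0 expn0 fact0 muln1 invr1 scale1r
            -derivX.
  by rewrite Rintegral_deriv_poly// !hornerX opprK.
rewrite legendreE /rodrigues derivnS -derivZ Rintegral_deriv_poly//.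
have [q] := derivn_expr_factor ('X ^+ 2 - 1 : {poly R}) 1 k.
rewrite addn1 expr1 => ->.
rewrite !hornerZ !hornerM !hornerD !hornerN !hornerXn !hornerC sqrrN.
by rewrite expr1n subrr !mul0r !mulr0 subrr mul0rn.
Qed.

Lemma bounded_horner (R : realType) (P : {poly R}) :
  exists2 M, 0 <= M & forall x, x \in `[-1, 1] -> `|P.[x]| <= M.
Proof.
exists (\sum_(i < size P) `|P`_i|); first by apply: sumr_ge0.
move=> x; rewrite in_itv /= -ler_norml => x1.
rewrite horner_coef (le_trans (ler_norm_sum _ _ _))//.
apply: ler_sum => i _; rewrite normrM ler_piMr// normrX exprn_ile1//.
Qed.

Lemma measurable_square (R : realType) : measurable (@square R : set (plane R)).
Proof. by apply: measurableX; exact: measurable_itv. Qed.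

Lemma measurable_hornerM (R : realType) (P Q : {poly R}) (D : set (plane R)) :
  measurable_fun D (fun p : plane R => P.[p.1] * Q.[p.2]).
Proof.
apply: measurable_funTS.
apply: measurable_funM.
  apply: (@measurableT_comp _ _ _ _ _ _ (horner P)); last exact: measurable_fst.
  exact: measurable_poly.
apply: (@measurableT_comp _ _ _ _ _ _ (horner Q)); last exact: measurable_snd.
exact: measurable_poly.
Qed.

Lemma lebesgue_measure_rect (R : realType) (a b c d : R) : a < b -> c < d ->
  area R (`[a, b] `*` `[c, d]) = ((b - a) * (d - c))%:E.
Proof.
move=> ab cd; rewrite product_measure1E; [|exact: measurable_itv..].
rewrite EFinM; congr (_ * _)%E; rewrite [LHS]lebesgue_measure_itv /= lte_fin.
- by rewrite ab -EFinD.
- by rewrite cd -EFinD.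
Qed.

Lemma measure_square (R : realType) : area R (@square R) = 4%:E.
Proof.
by rewrite lebesgue_measure_rect ?gtrN// opprK; congr EFin; ring.
Qed.

Lemma integrable_bounded_square (R : realType) (f : plane R -> R) (M : R) :
  measurable_fun (@square R : set (plane R)) f ->
  {in @square R, forall p, `|f p| <= M} ->
  (area R).-integrable (@square R) (EFin \o f).
Proof.
move=> mf fM; apply: measurable_bounded_integrable => //.
- exact: measurable_square.
- by rewrite [ltLHS]measure_square ltry.
- exists M; split; first exact: num_real.
  by move=> N MN p /mem_set sp; exact: le_trans (fM _ sp) (ltW MN).
Qed.

Lemma integrable_hornerM (R : realType) (P Q : {poly R}) :
  (area R).-integrable (@square R)
    (EFin \o (fun p : R * R => P.[p.1] * Q.[p.2])).
Proof.
have [M M0 PM] := bounded_horner P; have [N N0 QN] := bounded_horner Q.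
apply: (@integrable_bounded_square _ _ (M * N)); first exact: measurable_hornerM.
move=> p /set_mem [/= p1 p2]; rewrite normrM ler_pM//; [exact: PM|exact: QN].
Qed.

Lemma integrable_horner (R : realType) (P : {poly R}) (a b : R) :
  (@lebesgue_measure R).-integrable `[a, b] (EFin \o horner P).
Proof.
apply: continuous_compact_integrable; first exact: segment_compact.
by apply: continuous_subspaceT; exact: continuous_horner.
Qed.

(** The integral over the square is extended by zero to the whole plane, where
    Fubini's theorem applies. *)
Lemma Rintegral_square_hornerM (R : realType) (P Q : {poly R}) :
  \int[area R]_(p in @square R)
     (P.[p.1] * Q.[p.2]) =
  (\int[lebesgue_measure]_(x in `[(-1)%R, 1%R]) P.[x]) *
  (\int[lebesgue_measure]_(x in `[(-1)%R, 1%R]) Q.[x]).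
Proof.
set I := `[(-1)%R, 1%R]%classic : set R.
rewrite -RintegralZr; [|exact: measurable_itv|exact: integrable_horner].
rewrite /Rintegral; congr fine.
rewrite [LHS]integral_mkcond [RHS]integral_mkcond -integral12_prod_meas1; last first.
  have := integrable_hornerM P Q.
  by move/(iffLR (integrable_mkcond _ (@measurable_square R))); apply.
apply: eq_integral => x _; rewrite /fubini_F /=.
have [xI|xI] := boolP (x \in I).
  rewrite patchE xI.
  transitivity (\int[lebesgue_measure]_(y in I) (P.[x] * Q.[y])%:E)%E.
    rewrite [RHS]integral_mkcond; apply: eq_integral => y _.
    by rewrite !patchE /square in_setX /= xI.
  rewrite -[LHS]fineK; last first.
    apply: integrable_fin_num; first exact: measurable_itv.
    rewrite (_ : (fun _ => _) = EFin \o horner (P.[x] *: Q)).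
      exact: integrable_horner.
    by apply/funext => y /=; rewrite hornerZ.
  congr EFin.
  rewrite -[LHS]/(Rintegral _ _ _) RintegralZl//; first exact: measurable_itv.
  exact: integrable_horner.
rewrite patchE (negbTE xI); apply: integral0_eq => y _.
by rewrite patchE /square in_setX /= (negbTE xI).
Qed.

(** * Integrability of the Cauchy kernel *)

Definition dyadic_square (R : realType) (a b : R) (n : nat) : set (plane R) :=
  `[a - 2 / 2 ^+ n, a + 2 / 2 ^+ n] `*` `[b - 2 / 2 ^+ n, b + 2 / 2 ^+ n].

Definition dyadic_majorant (R : realType) (a b : R) (p : plane R) : \bar R :=
  (\sum_(0 <= n <oo) (2 ^+ n * \1_(dyadic_square a b n) p)%:E)%E.

Lemma measurable_dyadic_square (R : realType) (a b : R) n :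
  measurable (dyadic_square a b n).
Proof. by apply: measurableX; exact: measurable_itv. Qed.

Lemma dyadic_term_ge0 (R : realType) (a b : R) n p :
  (0 <= (2 ^+ n * \1_(dyadic_square a b n) p : R)%:E)%E.
Proof. by rewrite lee_fin mulr_ge0 ?exprn_ge0// indicE. Qed.

Lemma measurable_dyadic_term (R : realType) (a b : R) n (D : set (plane R)) :
  measurable_fun D (fun p => (2 ^+ n * \1_(dyadic_square a b n) p : R)%:E).
Proof.
apply/measurable_EFinP; apply: measurable_funM; first exact: measurable_cst.
by apply: measurable_indic; exact: measurable_dyadic_square.
Qed.

Lemma measurable_dyadic_majorant (R : realType) (a b : R) (D : set (plane R)) :
  measurable_fun D (dyadic_majorant a b).
Proof.
apply: ge0_emeasurable_sum => [n x _ _|n _]; first exact: dyadic_term_ge0.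
exact: measurable_dyadic_term.
Qed.

(** Each term has integral [2^n (4 / 2^n)^2 = 16 / 2^n = 32 / 2^(n+1)]; the last
    form is that of the geometric series with sum 32. *)
Lemma integrable_dyadic_majorant (R : realType) (a b : R) :
  (area R).-integrable setT (dyadic_majorant a b).
Proof.
apply/integrableP; split; first exact: measurable_dyadic_majorant.
under eq_integral.
  move=> p _; rewrite gee0_abs; last first.
    by apply: nneseries_ge0 => n _ _; exact: dyadic_term_ge0.
  over.
rewrite integral_nneseries => [|//|n|n p _]; last 2 first.
- exact: measurable_dyadic_term.
- exact: dyadic_term_ge0.
rewrite (eq_eseriesr (g := fun n => (32 / (2 ^ (n + 1))%:R)%:E)); last first.
  move=> n _; under eq_integral do rewrite EFinM.
  have h0 : 0 < 2 ^+ n :> R by rewrite exprn_gt0.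
  rewrite ge0_integralZl//; last first.
    apply/measurable_EFinP; apply: measurable_indic.
    exact: measurable_dyadic_square.
  rewrite integral_indic//; last exact: measurable_dyadic_square.
  rewrite setIT [X in (_ * X)%E]lebesgue_measure_rect; last 2 first.
  - by rewrite ltrD2l gtrN// divr_gt0.
  - by rewrite ltrD2l gtrN// divr_gt0.
  rewrite -EFinM; congr EFin; rewrite natrX exprD expr1.
  by field; rewrite gt_eqF.
have /cvg_lim -> // := @cvg_geometric_eseries_half R 32 0.
exact: ltry.
Qed.

(** For [0 < m < 1] a single term suffices: take n least with [m^-1 <= 2^n].
    Minimality gives [m <= 2 / 2^n], so p lies in the n-th square. *)
Lemma inv_le_dyadic_majorant (R : realType) (a b m : R) (p : plane R) :
  `|a - p.1| <= m -> `|b - p.2| <= m ->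
  ((m^-1)%:E <= 1 + dyadic_majorant a b p)%E.
Proof.
move=> am bm.
have G0 : (0 <= dyadic_majorant a b p)%E.
  by apply: nneseries_ge0 => n _ _; exact: dyadic_term_ge0.
have m0 : 0 <= m by exact: le_trans am.
have [m1|m1] := leP 1 m.
  apply: (@le_trans _ _ 1%E); last by rewrite leeDl.
  by rewrite lee_fin invf_le1// (lt_le_trans ltr01).
move: m0; rewrite le_eqVlt => /predU1P[<-|m0]; first by rewrite invr0 adde_ge0.
have exN : exists n, m^-1 <= 2 ^+ n.
  exists (Num.bound m^-1).
  have mV : 0 <= m^-1 by rewrite invr_ge0 ltW.
  rewrite (le_trans (ltW (archi_boundP mV)))// -natrX ler_nat ltnW//.
  exact: ltn_expl.
case: (ex_minnP exN) => n nm nmin.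
have {}nmin : 2 ^+ n < 2 * m^-1.
  case: n nm nmin => [|n] nm nmin.
    have : 1 < m^-1 by rewrite invf_gt1.
    by rewrite expr0; lra.
  rewrite exprS ltr_pM2l// ltNge; apply/negP => /nmin; by rewrite ltnn.
have inB : \1_(dyadic_square a b n) p = 1 :> R.
  have mr : m <= 2 / 2 ^+ n.
    rewrite ler_pdivlMr ?exprn_gt0// mulrC -ler_pdivlMr//; exact: ltW.
  rewrite indicE mem_set//; split; rewrite /= in_itv /=.
  - by move: (le_trans am mr); rewrite ler_norml => /andP[? ?]; lra.
  - by move: (le_trans bm mr); rewrite ler_norml => /andP[? ?]; lra.
apply: (@le_trans _ _ (dyadic_majorant a b p)); last by rewrite leeDr.
apply: (@le_trans _ _
  (\sum_(0 <= i < n.+1) (2 ^+ i * \1_(dyadic_square a b i) p)%:E)%E).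
  rewrite big_nat_recr//= inB mulr1 -[leLHS]add0e leeD ?lee_fin//.
  by apply: sume_ge0 => i _; exact: dyadic_term_ge0.
by apply: nneseries_lim_ge => i _ _; exact: dyadic_term_ge0.
Qed.

(** The maximum norm stands for the distance to [(a, b)], so that the sets
    where it is small are squares, whose area is a product of lengths. *)
Lemma integrable_inv_distance (R : realType) (a b M : R) (f : plane R -> R) :
  measurable_fun (@square R : set (plane R)) f ->
  (forall p, square p -> `|f p| <= M / Num.max `|a - p.1| `|b - p.2|) ->
  (area R).-integrable (@square R) (EFin \o f).
Proof.
move=> mf fM.
have int1G : (area R).-integrable (@square R)
    (fun p => M%:E * (1 + dyadic_majorant a b p))%E.
  apply: integrableZl; first exact: measurable_square.
  apply: integrableD; first exact: measurable_square.
  - apply: (@integrable_bounded_square _ (cst 1) 1); first exact: measurable_cst.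
    by move=> p _; rewrite normr1.
  - apply: integrableS (integrable_dyadic_majorant a b) => //.
    exact: measurable_square.
apply: le_integrable int1G.
- exact: measurable_square.
- exact/measurable_EFinP.
move=> p sp /=.
pose m := Num.max `|a - p.1| `|b - p.2|.
have am : `|a - p.1| <= m by rewrite le_max lexx.
have bm : `|b - p.2| <= m by rewrite le_max lexx orbT.
have m0 : 0 <= m by exact: le_trans am.
have := fM _ sp; rewrite -/m.
move: m0; rewrite le_eqVlt => /predU1P[m0|m0 fpM].
  (* At the centre the bound is M / 0 = 0, so f vanishes there. *)
  by rewrite -m0 invr0 mulr0 => h; rewrite (le_trans _ (abse_ge0 _)) ?lee_fin.
have M0 : 0 <= M.
  by rewrite -(pmulr_lge0 _ (_ : 0 < m^-1)) ?invr_gt0// (le_trans _ fpM).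
apply: le_trans (lee_abs _).
apply: (@le_trans _ _ (M%:E * (m^-1)%:E)%E); first by rewrite -EFinM lee_fin.
by apply: lee_wpmul2l; [rewrite lee_fin|exact: inv_le_dyadic_majorant].
Qed.

(** * Complex-valued integrals *)

Definition cintegrable2 (R : realType) (D : set (R * R)) (f : R * R -> R[i]) :=
  (area R).-integrable D (EFin \o (fun p => complex.Re (f p))) /\
  (area R).-integrable D (EFin \o (fun p => complex.Im (f p))).

Lemma ReM (R : realType) (x y : R[i]) :
  complex.Re (x * y) = complex.Re x * complex.Re y - complex.Im x * complex.Im y.
Proof. by case: x; case: y. Qed.

Lemma ImM (R : realType) (x y : R[i]) :
  complex.Im (x * y) = complex.Re x * complex.Im y + complex.Im x * complex.Re y.
Proof. by case: x; case: y. Qed.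

Lemma ReD (R : realType) (x y : R[i]) :
  complex.Re (x + y) = complex.Re x + complex.Re y.
Proof. by case: x; case: y. Qed.

Lemma ImD (R : realType) (x y : R[i]) :
  complex.Im (x + y) = complex.Im x + complex.Im y.
Proof. by case: x; case: y. Qed.

Lemma complexE (R : realType) (x : R[i]) : x = complex.Re x +i* complex.Im x.
Proof. by case: x. Qed.

Lemma cintegrable2D (R : realType) (D : set (R * R)) (f g : R * R -> R[i]) :
  measurable (D : set (plane R)) -> cintegrable2 D f -> cintegrable2 D g ->
  cintegrable2 D (fun p => f p + g p).
Proof.
move=> mD [fr fi] [gr gi]; split.
- rewrite (_ : _ \o _ = (EFin \o (fun p => complex.Re (f p)))
                     \+ (EFin \o (fun p => complex.Re (g p))))%E.
    exact: integrableD.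
  by apply/funext => p /=; rewrite ReD.
- rewrite (_ : _ \o _ = (EFin \o (fun p => complex.Im (f p)))
                     \+ (EFin \o (fun p => complex.Im (g p))))%E.
    exact: integrableD.
  by apply/funext => p /=; rewrite ImD.
Qed.

Lemma cintegral2D (R : realType) (D : set (R * R)) (f g : R * R -> R[i]) :
  measurable (D : set (plane R)) -> cintegrable2 D f -> cintegrable2 D g ->
  cintegral2 D (fun p => f p + g p) = cintegral2 D f + cintegral2 D g.
Proof.
move=> mD [fr fi] [gr gi]; rewrite /cintegral2.
under eq_Rintegral do rewrite ReD.
under [X in _ +i* X]eq_Rintegral do rewrite ImD.
by rewrite RintegralD// RintegralD.
Qed.

Lemma cintegrable2Z (R : realType) (D : set (R * R)) (c : R[i])
    (f : R * R -> R[i]) :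
  measurable (D : set (plane R)) -> cintegrable2 D f ->
  cintegrable2 D (fun p => c * f p).
Proof.
move=> mD [fr fi]; split.
- rewrite (_ : _ \o _ =
      (fun p => (complex.Re c)%:E * (EFin \o (@complex.Re R \o f)) p)
      \+ (fun p => (- complex.Im c)%:E * (EFin \o (@complex.Im R \o f)) p))%E.
    by apply: integrableD => //; exact: integrableZl.
  by apply/funext => p /=; rewrite ReM -mulNr.
- rewrite (_ : _ \o _ =
      (fun p => (complex.Re c)%:E * (EFin \o (@complex.Im R \o f)) p)
      \+ (fun p => (complex.Im c)%:E * (EFin \o (@complex.Re R \o f)) p))%E.
    by apply: integrableD => //; exact: integrableZl.
  by apply/funext => p /=; rewrite ImM.
Qed.

Lemma cintegral2Z (R : realType) (D : set (R * R)) (c : R[i])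
    (f : R * R -> R[i]) :
  measurable (D : set (plane R)) -> cintegrable2 D f ->
  cintegral2 D (fun p => c * f p) = c * cintegral2 D f.
Proof.
move=> mD [fr fi]; rewrite [RHS]complexE ReM ImM /cintegral2 /=.
under eq_Rintegral do rewrite ReM -mulNr.
under [X in _ +i* X]eq_Rintegral do rewrite ImM.
have iZ (r : R) (h : plane R -> R) : (area R).-integrable D (EFin \o h) ->
  (area R).-integrable D (EFin \o (fun p => r * h p)).
  by move=> /(integrableZl mD r).
rewrite RintegralD//; [|exact: iZ..].
rewrite [X in _ +i* X]RintegralD//; [|exact: iZ..].
by rewrite !RintegralZl// mulNr.
Qed.

Lemma setX_set1 (T U : Type) (p : T * U) : [set p] = [set p.1] `*` [set p.2].
Proof.
apply/seteqP; split => [q /= ->//|q /= [q1 q2]].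
by case: p q q1 q2 => [? ?] [? ?] /= -> ->.
Qed.

Lemma area_set1 (R : realType) (p : plane R) : area R [set p] = 0.
Proof.
rewrite setX_set1 product_measure1E; [|exact: measurable_set1..].
by rewrite [X in (X * _)%E]lebesgue_measure_set1 mul0e.
Qed.

Lemma cintegral2_eq_off_point (R : realType) (D : set (R * R))
    (f g : R * R -> R[i]) (p0 : R * R) :
  measurable (D : set (plane R)) -> cintegrable2 D f -> cintegrable2 D g ->
  (forall p, p != p0 -> f p = g p) ->
  cintegral2 D f = cintegral2 D g.
Proof.
move=> mD [fr fi] [gr gi] fg.
have m1 : measurable ([set p0] : set (plane R)).
  by rewrite setX_set1; apply: measurableX; exact: measurable_set1.
have off (h : R[i] -> R) :
    ae_eq (area R) D (EFin \o (h \o f)) (EFin \o (h \o g)).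
  exists [set p0]; split => //; first exact: area_set1.
  move=> p /= /not_implyP [_ hp]; apply: contrapT => /eqP pp0; apply: hp.
  by rewrite fg.
rewrite /cintegral2 /Rintegral; congr (fine _ +i* fine _).
- apply: ae_eq_integral => //.
  + exact: measurable_int fr.
  + exact: measurable_int gr.
  + exact: off.
- apply: ae_eq_integral => //.
  + exact: measurable_int fi.
  + exact: measurable_int gi.
  + exact: off.
Qed.

(** * The Cauchy transform of a product of polynomials *)

Definition cauchy_kernel (R : realType) (z : R[i]) (P Q : {poly R}) (p : R * R) :=
  (P.[p.1])%:C * (Q.[p.2])%:C / (z - (p.1 +i* p.2)).

Lemma Re_cauchy_kernel (R : realType) (z : R[i]) (P Q : {poly R}) p :
  complex.Re (cauchy_kernel z P Q p) = P.[p.1] * Q.[p.2] *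
  ((complex.Re z - p.1) *
   ((complex.Re z - p.1) ^+ 2 + (complex.Im z - p.2) ^+ 2)^-1).
Proof. by case: z => x y; rewrite /cauchy_kernel ReM /=; ring. Qed.

Lemma Im_cauchy_kernel (R : realType) (z : R[i]) (P Q : {poly R}) p :
  complex.Im (cauchy_kernel z P Q p) = P.[p.1] * Q.[p.2] *
  ((p.2 - complex.Im z) *
   ((complex.Re z - p.1) ^+ 2 + (complex.Im z - p.2) ^+ 2)^-1).
Proof. by case: z => x y; rewrite /cauchy_kernel ImM /=; ring. Qed.

Lemma measurable_inv_sumsq d (T : measurableType d) (R : realType) (D : set T)
    (f g : T -> R) :
  measurable_fun D f -> measurable_fun D g ->
  measurable_fun D (fun p => (f p ^+ 2 + g p ^+ 2)^-1).
Proof.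
move=> mf mg.
(* On nonnegative reals, 0 included, the inverse is the power -1. *)
rewrite (_ : (fun p => _) =
  (fun x : R => x `^ (-1)) \o (fun p => f p ^+ 2 + g p ^+ 2)).
  apply: measurableT_comp; first exact: measurable_powR.
  by apply: measurable_funD; exact: measurable_funX.
by apply/funext => p /=; rewrite powR_inv1// addr_ge0// sqr_ge0.
Qed.

(** Applied with t one of x and -y: the real and imaginary parts of
    [1 / (x + i y)] are at most the inverse of the maximum norm. *)
Lemma ratio_sumsq_le (R : realFieldType) (x y t : R) :
  `|t| <= Num.max `|x| `|y| ->
  `|t * (x ^+ 2 + y ^+ 2)^-1| <= (Num.max `|x| `|y|)^-1.
Proof.
set m := Num.max _ _ => tm.
have m0 : 0 <= m by exact: le_trans tm.
have m2 : m ^+ 2 <= x ^+ 2 + y ^+ 2.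
  rewrite -(real_normK (num_real x)) -(real_normK (num_real y)) /m.
  by case: (leP `|x| `|y|) => _; rewrite ?lerDl ?lerDr sqr_ge0.
move: m0; rewrite le_eqVlt => /predU1P[m0|m0].
  move: tm; rewrite -m0 normr_le0 => /eqP ->.
  by rewrite mul0r normr0 invr0.
have s0 : 0 < x ^+ 2 + y ^+ 2 by rewrite (lt_le_trans _ m2)// exprn_gt0.
rewrite normrM (ger0_norm (_ : 0 <= (_ + _)^-1)) ?invr_ge0 ?(ltW s0)//.
rewrite ler_pdivrMr// (le_trans tm)// mulrC ler_pdivlMr// -expr2//.
Qed.

Lemma cintegrable_cauchy_kernel (R : realType) (z : R[i]) (P Q : {poly R}) :
  cintegrable2 (@square R) (cauchy_kernel z P Q).
Proof.
have [M M0 PM] := bounded_horner P; have [N N0 QN] := bounded_horner Q.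
have PQ p : square p -> `|P.[p.1] * Q.[p.2]| <= M * N.
  by move=> [/= p1 p2]; rewrite normrM ler_pM//; [exact: PM|exact: QN].
have m1 : measurable_fun (@square R : set (plane R))
    (fun p => complex.Re z - p.1).
  apply: measurable_funB; first exact: measurable_cst.
  by apply: measurable_funTS; exact: measurable_fst.
have m2 : measurable_fun (@square R : set (plane R))
    (fun p => complex.Im z - p.2).
  apply: measurable_funB; first exact: measurable_cst.
  by apply: measurable_funTS; exact: measurable_snd.
have m2' : measurable_fun (@square R : set (plane R))
    (fun p => p.2 - complex.Im z).
  apply: measurable_funB; last exact: measurable_cst.
  by apply: measurable_funTS; exact: measurable_snd.
have mV := measurable_inv_sumsq m1 m2.
split; apply: (@integrable_inv_distance _ (complex.Re z) (complex.Im z) (M * N)).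
- under eq_fun do rewrite Re_cauchy_kernel.
  apply: measurable_funM; first exact: measurable_hornerM.
  exact: measurable_funM.
- move=> p sp; rewrite Re_cauchy_kernel normrM ler_pM// ?PQ//.
  by apply: ratio_sumsq_le; rewrite le_max lexx.
- under eq_fun do rewrite Im_cauchy_kernel.
  apply: measurable_funM; first exact: measurable_hornerM.
  exact: measurable_funM.
- move=> p sp; rewrite Im_cauchy_kernel normrM ler_pM// ?PQ//.
  by apply: ratio_sumsq_le; rewrite distrC le_max lexx orbT.
Qed.

Definition cauchy_transform (R : realType) (z : R[i]) (P Q : {poly R}) : R[i] :=
  cintegral2 (@square R) (cauchy_kernel z P Q).

Lemma cauchy_transform_combl (R : realType) (z : R[i]) (a b : R)
    (P1 P2 Q : {poly R}) :
  cauchy_transform z (a *: P1 + b *: P2) Q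
  = a%:C * cauchy_transform z P1 Q + b%:C * cauchy_transform z P2 Q.
Proof.
have i1 := cintegrable_cauchy_kernel z P1 Q.
have i2 := cintegrable_cauchy_kernel z P2 Q.
have mS := @measurable_square R.
rewrite /cauchy_transform -!cintegral2Z// -cintegral2D//; last 2 first.
- exact: cintegrable2Z.
- exact: cintegrable2Z.
congr cintegral2; apply/funext => p.
by rewrite /cauchy_kernel hornerD !hornerZ rmorphD !rmorphM; ring.
Qed.

Lemma cauchy_transform_combr (R : realType) (z : R[i]) (a b : R)
    (P Q1 Q2 : {poly R}) :
  cauchy_transform z P (a *: Q1 + b *: Q2)
  = a%:C * cauchy_transform z P Q1 + b%:C * cauchy_transform z P Q2.
Proof.
have i1 := cintegrable_cauchy_kernel z P Q1.
have i2 := cintegrable_cauchy_kernel z P Q2.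
have mS := @measurable_square R.
rewrite /cauchy_transform -!cintegral2Z// -cintegral2D//; last 2 first.
- exact: cintegrable2Z.
- exact: cintegrable2Z.
congr cintegral2; apply/funext => p.
by rewrite /cauchy_kernel hornerD !hornerZ rmorphD !rmorphM; ring.
Qed.

Lemma cintegrable2_real (R : realType) (D : set (R * R)) (f : R * R -> R) :
  (area R).-integrable D (EFin \o f) -> cintegrable2 D (fun p => (f p)%:C).
Proof. by move=> fi; split => //=; exact: integrable0. Qed.

Lemma mul_cauchy_kernel (R : realType) (z : R[i]) (P Q : {poly R}) p :
  z != p.1 +i* p.2 ->
  z * cauchy_kernel z P Q p = (P.[p.1] * Q.[p.2])%:C
    + (cauchy_kernel z ('X * P) Q p + 'i%C * cauchy_kernel z P ('X * Q) p).
Proof.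
rewrite -subr_eq0 => zp; rewrite /cauchy_kernel !hornerM !hornerX !rmorphM.
have e : p.1 +i* p.2 = (p.1)%:C + 'i%C * (p.2)%:C.
  by apply/eqP; rewrite eq_complex /=; apply/andP; split; apply/eqP; ring.
by move: zp; rewrite e => zp; field.
Qed.

(** At the point z the integrand on the left is 0 and that on the right is in
    general not, which a set of measure zero does not see. *)
Lemma mul_cauchy_transform (R : realType) (z : R[i]) (P Q : {poly R}) :
  z * cauchy_transform z P Q =
  cauchy_transform z ('X * P) Q + 'i%C * cauchy_transform z P ('X * Q)
  + ((\int[lebesgue_measure]_(x in `[(-1)%R, 1%R]) P.[x]) *
     (\int[lebesgue_measure]_(x in `[(-1)%R, 1%R]) Q.[x]))%:C.
Proof.
have mS := @measurable_square R.
have iK := cintegrable_cauchy_kernel z P Q.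
have iX := cintegrable_cauchy_kernel z ('X * P) Q.
have iY := cintegrable2Z 'i%C mS (cintegrable_cauchy_kernel z P ('X * Q)).
have iPQ := cintegrable2_real (integrable_hornerM P Q).
rewrite /cauchy_transform -!cintegral2Z//; last exact: cintegrable_cauchy_kernel.
rewrite -cintegral2D// addrC -Rintegral_square_hornerM.
have -> : (\int[area R]_(p in @square R) (P.[p.1] * Q.[p.2]))%:C =
    cintegral2 (@square R) (fun p => (P.[p.1] * Q.[p.2])%:C).
  rewrite /cintegral2 /= /Rintegral.
  by rewrite [X in _ +i* fine X]integral0.
rewrite -cintegral2D//; last exact: cintegrable2D.
apply: (@cintegral2_eq_off_point _ _ _ _ (complex.Re z, complex.Im z) mS).
- exact: cintegrable2Z.
- by apply: cintegrable2D => //; exact: cintegrable2D.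
move=> p pz; apply: mul_cauchy_kernel; apply: contra_neq pz.
by case: p => x y ->.
Qed.

(** * The matrix identity *)

(** The coefficients are those of [legendre_recurrence]. *)
Lemma tridiagonal_sum (R : realType) (k : nat) (C : nat -> R[i]) :
  \sum_(l \in [set: nat]) Bmx R k l * C l =
  (k%:R / (2 * k + 1)%:R)%:C * C k.-1 + ((k + 1)%:R / (2 * k + 1)%:R)%:C * C k.+1.
Proof.
rewrite -(@fsbig_widen _ _ _ _ `I_k.+2) //; last first.
  move=> l [_ /= /negP]; rewrite -leqNgt => kl; rewrite /Bmx.
  rewrite ifF; last by apply/negbTE; lia.
  by rewrite ifF ?mul0r//; apply/negbTE; lia.
rewrite -fsbig_ord !rmorphM !fmorphV !rmorph_nat.
rewrite big_ord_recr /= {2}/Bmx ifF ?eqxx; last by apply/negbTE; lia.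
congr (_ + _); rewrite big_ord_recr /= {2}/Bmx !ifF; try by apply/negbTE; lia.
rewrite mul0r addr0.
case: k => [|k]; first by rewrite big_ord0 !mul0r.
rewrite big_ord_recr /= {2}/Bmx eqxx big1 ?add0r// => i _; rewrite /Bmx.
by rewrite !ifF ?mul0r//; apply/negbTE; have := ltn_ord i; lia.
Qed.

Theorem lemma4p1 (R : realType) (z : R[i]) (k j : nat) :
  z * Smx z k j =
    infmx_mul (Bmx R) (Smx z) k j
    + 'i%C * infmx_mul (Smx z) (infmx_tr (Bmx R)) k j
    + 4 * inf_outer (@inf_e0 R[i]) (@inf_e0 R[i]) k j.
Proof.
have SE k' j' : Smx z k' j' = cauchy_transform z (legendre R k') (legendre R j').
  by [].
have -> : infmx_mul (Smx z) (infmx_tr (Bmx R)) k j =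
    \sum_(l \in [set: nat]) Bmx R j l * Smx z k l.
  by apply: eq_fsbigr => l _; rewrite /infmx_tr mulrC.
rewrite /infmx_mul (tridiagonal_sum k (Smx z ^~ j)) (tridiagonal_sum j (Smx z k)).
rewrite !SE mul_cauchy_transform.
rewrite !legendre_recurrence cauchy_transform_combl cauchy_transform_combr.
congr (_ + _); rewrite !Rintegral_legendre /inf_outer /inf_e0.
by rewrite rmorphM !rmorphMn !rmorph1; ring.
Qed.
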